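(* Let $G$ be a group, $R$ a commutative $G$-graded ring with nonzero unity, and $M$ a nonzero $G$-graded $R$-module. Then every graded pure $R$-submodule of $M$ is a graded $r$-submodule of $M$.
   Context: A commutative ring $R$ is $G$-graded if $R=\bigoplus_{g\in G}R_g$ with additive subgroups $R_g$ satisfying $R_gR_h\subseteq R_{gh}$; an $R$-module $M$ is $G$-graded if $M=\bigoplus_{g\in G}M_g$ with additive subgroups $M_g$ satisfying $R_gM_h\subseteq M_{gh}$. Put $h(R)=\bigcup_{g\in G}R_g$ and $h(M)=\bigcup_{g\in G}M_g$. An $R$-submodule $K$ of $M$ is graded if $K=\bigoplus_{g\in G}(K\cap M_g)$. For $a\in R$, $Ann_M(a)=\{m\in M: am=0\}$. A proper graded $R$-submodule $K$ of $M$ is graded pure if $aM\cap K=aK$ for all $a\in h(R)$. A proper graded $R$-submodule $K$ of $M$ is a graded $r$-submodule if whenever $a\in h(R)$ and $x\in h(M)$ satisfy $ax\in K$ and $Ann_M(a)=\{0\}$, then $x\in K$. *)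

(* Defs.v *)
From mathcomp Require Import all_boot all_order all_algebra all_classical.
Set Implicit Arguments.
Unset Strict Implicit.
Unset Printing Implicit Defensive.
Import GRing.Theory.
Local Open Scope classical_set_scope.
Local Open Scope ring_scope.

Section DirectSum.
Variables (G : choiceType) (V : zmodType).

(* The finiteness clause cannot be dropped: a sum over an infinite support is 0
   by convention. *)
Definition decomposition (B : G -> set V) (x : V) (f : G -> V) : Prop :=
  [/\ forall g, B g (f g),
      finite_set [set g | f g != 0] &
      x = \sum_(g \in [set: G]) f g].

(* A is the internal direct sum of the family B of additive subgroups of V. *)
Definition direct_sum (A : set V) (B : G -> set V) : Prop :=
  [/\ forall g, GRing.zmod_closed (mem (B g)),
      forall g, B g `<=` A &
      forall x, A x -> exists! f : G -> V, decomposition B x f].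

Definition homogeneous (B : G -> set V) : set V := \bigcup_g B g.

End DirectSum.

Section Graded.
Variables (G : groupType) (R : comNzRingType) (M : lmodType R).

Definition graded_ring (Rg : G -> set R) : Prop :=
  direct_sum [set: R] Rg /\
  forall (g h : G) (a b : R), Rg g a -> Rg h b -> Rg (g * h)%g (a * b).

Definition graded_module (Rg : G -> set R) (Mg : G -> set M) : Prop :=
  direct_sum [set: M] Mg /\
  forall (g h : G) (a : R) (m : M), Rg g a -> Mg h m -> Mg (g * h)%g (a *: m).

Definition graded_submodule (Mg : G -> set M) (K : set M) : Prop :=
  GRing.submod_closed (mem K) /\ direct_sum K (fun g => K `&` Mg g).

Definition annihilator (a : R) : set M := [set m : M | a *: m = 0].

Definition graded_pure (Rg : G -> set R) (Mg : G -> set M) (K : set M) : Prop :=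
  [/\ graded_submodule Mg K, K <> [set: M] &
      forall a : R, homogeneous Rg a ->
        [set a *: m | m in [set: M]] `&` K = [set a *: k | k in K]].

Definition graded_r_submodule (Rg : G -> set R) (Mg : G -> set M) (K : set M)
    : Prop :=
  [/\ graded_submodule Mg K, K <> [set: M] &
      forall (a : R) (x : M), homogeneous Rg a -> homogeneous Mg x ->
        K (a *: x) -> annihilator a = [set 0] -> K x].

End Graded.

(* Main.v *)
Require Import Defs.
From mathcomp Require Import all_boot all_order all_algebra all_classical.
Local Open Scope classical_set_scope.
Local Open Scope ring_scope.

(** Purity rewrites the element [a *: x] of [aM] meeting [K] as [a *: k] with
    [k] in [K]; since [a] annihilates only [0], it can be cancelled, so
    [x = k]. *)
Theorem corollary3p13 (G : groupType) (R : comNzRingType) (M : lmodType R)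
    (Rg : G -> set R) (Mg : G -> set M)
    (gradedR : graded_ring Rg) (gradedM : graded_module Rg Mg)
    (M_neq0 : exists m : M, m != 0)
    (K : set M) :
  graded_pure Rg Mg K -> graded_r_submodule Rg Mg K.
Proof.
move=> [gradedK properK pureK]; split=> // a x ha _ Kax ann0.
have : ([set a *: m | m in [set: M]] `&` K) (a *: x) by split=> //; exists x.
rewrite pureK // => -[k Kk eq_ak_ax].
have : (annihilator a : set M) (x - k).
  by rewrite /annihilator /= GRing.Theory.scalerBr eq_ak_ax GRing.Theory.subrr.
by rewrite ann0 => /GRing.Theory.subr0_eq ->.
Qed.
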